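(* Let $F:\mathbb{R}\to\mathbb{R}$ be a flux function, let $\Delta x,\Delta t>0$, write $F_j^n=F(C_j^n)$, and consider the variable relaxed scheme with second order spatial discretization and forward Euler time stepping $$C_j^{n+1}=C_j^n-\frac{\Delta t}{\Delta x}\left(\mathcal F_{j+\frac12}^n-\mathcal F_{j-\frac12}^n\right)-\frac{\Delta t}{\Delta x}\left(\tilde{\mathcal F}_{j+\frac12}^n-\tilde{\mathcal F}_{j-\frac12}^n\right),\qquad j\in\mathbb{Z},$$ where $$\mathcal F_{j-\frac12}^n=F_{j-1}^n+\frac{-a_{j-\frac12}^-}{a_{j-\frac12}^+-a_{j-\frac12}^-}\left[F_j^n-F_{j-1}^n-a_{j-\frac12}^+\left(C_j^n-C_{j-1}^n\right)\right],$$ $$\tilde{\mathcal F}_{j-\frac12}^n=\frac{a_{j-\frac12}^+}{a_{j-\frac12}^+-a_{j-\frac12}^-}\,\frac{\phi(\theta_{j-\frac12}^+)}{2}\left[-a_{j-\frac12}^-\left(C_j^n-C_{j-1}^n\right)+\left(F_j^n-F_{j-1}^n\right)\right]-\frac{a_{j-\frac12}^-}{a_{j-\frac12}^+-a_{j-\frac12}^-}\,\frac{\phi(\theta_{j-\frac12}^-)}{2}\left[a_{j-\frac12}^+\left(C_j^n-C_{j-1}^n\right)-\left(F_j^n-F_{j-1}^n\right)\right],$$ with $\phi$ the van Leer limiter and $\theta^{\pm}_{j-\frac12}$ the limiter parameters defined in the context. Then the scheme is TVD under the CFL condition $\frac{\Delta t}{\Delta x}a_{\max}\le\frac12$ and the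 following local subcharacteristic condition, required for all $j$: (1) in the symmetric case ($a_{j-\frac12}^+=-a_{j-\frac12}^-=a_{j-\frac12}$): $$a_{j-\frac12}\ge\left|\frac{F(C_j^n)-F(C_{j-1}^n)}{C_j^n-C_{j-1}^n}\right|;$$ (2) in the optimal case: $$a_{j-\frac12}^-\le\min\left(\frac{F(C_j^n)-F(C_{j-1}^n)}{C_j^n-C_{j-1}^n},0\right),\qquad a_{j-\frac12}^+\ge\max\left(\frac{F(C_j^n)-F(C_{j-1}^n)}{C_j^n-C_{j-1}^n},0\right).$$
   Context: The scheme approximates the scalar conservation law $C_t+F(C)_x=0$ on a uniform grid with cells indexed by $j\in\mathbb{Z}$, cell width $\Delta x$ and time step $\Delta t$; $C_j^n$ is the approximate cell average in cell $j$ at time level $n$. Local subcharacteristic speeds: at each time step, each cell interface $j-\frac12$ carries real numbers $a_{j-\frac12}^-\le 0\le a_{j-\frac12}^+$ with $a_{j-\frac12}^+-a_{j-\frac12}^->0$. $a_{\max}$ denotes the maximum subcharacteristic speed, $a_{\max}=\sup_j\max(a_{j-\frac12}^+,|a_{j-\frac12}^-|)$ (assumed finite). In the subcharacteristic conditions, the difference quotient is considered only where $C_j^n\ne C_{j-1}^n$. Van Leer limiter: $\phi(\theta)=\dfrac{\theta+|\theta|}{1+|\theta|}$. Limiter parameters: $$\theta_{j-\frac12}^+=\frac{\dfrac{1+a_{j-\frac12}^+a_{j-\frac32}^+}{a_{j-\frac32}^+-a_{j-\frac32}^-}\left[-a_{j-\frac32}^-\left(C_{j-1}^n-C_{j-2}^n\right)+\left(F_{j-1}^n-F_{j-2}^n\right)\right]}{\dfrac{1+a_{j-\frac12}^+a_{j-\frac12}^+}{a_{j-\frac12}^+-a_{j-\frac12}^-}\left[-a_{j-\frac12}^-\left(C_j^n-C_{j-1}^n\right)+\left(F_j^n-F_{j-1}^n\right)\right]},$$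 $$\theta_{j-\frac12}^-=\frac{\dfrac{1+a_{j+\frac12}^-a_{j-\frac12}^-}{a_{j+\frac12}^+-a_{j+\frac12}^-}\left[a_{j+\frac12}^+\left(C_{j+1}^n-C_j^n\right)-\left(F_{j+1}^n-F_j^n\right)\right]}{\dfrac{1+a_{j-\frac12}^-a_{j-\frac12}^-}{a_{j-\frac12}^+-a_{j-\frac12}^-}\left[a_{j-\frac12}^+\left(C_j^n-C_{j-1}^n\right)-\left(F_j^n-F_{j-1}^n\right)\right]}.$$ When the denominator of $\theta^{\pm}_{j-\frac12}$ vanishes, the bracket multiplying $\phi(\theta^{\pm}_{j-\frac12})$ in $\tilde{\mathcal F}_{j-\frac12}^n$ vanishes as well, and that term is taken to be $0$. TVD (total variation diminishing): $\sum_{j}|C_{j+1}^{n+1}-C_j^{n+1}|\le\sum_j|C_{j+1}^n-C_j^n|$ for every grid function $C^n$ of finite total variation (with the speeds at time level $n$ satisfying the stated conditions). *)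

(* Defs.v *)
From HB Require Import structures.
From mathcomp Require Import all_boot all_order all_algebra.
From mathcomp Require Import all_classical all_reals all_analysis.

Set Implicit Arguments.
Unset Strict Implicit.
Unset Printing Implicit Defensive.

Import Order.TTheory GRing.Theory Num.Theory.

Local Open Scope classical_set_scope.
Local Open Scope ring_scope.

(* Cells are indexed by j : int.  A quantity living on the interface j - 1/2
   is indexed by j, so that j - 3/2 is j - 1 and j + 1/2 is j + 1:
   [ap j] is a^+_{j-1/2} and [am j] is a^-_{j-1/2}. *)

Section RelaxedScheme.
Variable R : realType.

Definition van_leer (t : R) : R := (t + `|t|) / (1 + `|t|).

Definition grid_tv (C : int -> R) : \bar R :=
  \esum_(j in [set: int]) (`|C (j + 1) - C j|)%:E.

Section Speeds.
Variables ap am : int -> R.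

Definition speeds_ok : Prop :=
  forall j, am j <= 0 /\ 0 <= ap j /\ 0 < ap j - am j.

Definition speed_set : set R := range (fun j => Num.max (ap j) `|am j|).

Definition a_max : R := sup speed_set.

Section Flux.
Variables (F : R -> R) (C : int -> R).

Definition bracket_p (j : int) : R :=
  - am j * (C j - C (j - 1)) + (F (C j) - F (C (j - 1))).

Definition bracket_m (j : int) : R :=
  ap j * (C j - C (j - 1)) - (F (C j) - F (C (j - 1))).

(* If the denominator of [theta_p j] vanishes, then so does [bracket_p j]
   (the other factor is positive under [speeds_ok]), hence the corresponding
   term of [flux2 j] is 0 whatever the value of the quotient; likewise for
   [theta_m] and [bracket_m]. *)
Definition theta_p (j : int) : R :=
  ((1 + ap j * ap (j - 1)) / (ap (j - 1) - am (j - 1)) * bracket_p (j - 1)) /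
  ((1 + ap j * ap j) / (ap j - am j) * bracket_p j).

Definition theta_m (j : int) : R :=
  ((1 + am (j + 1) * am j) / (ap (j + 1) - am (j + 1)) * bracket_m (j + 1)) /
  ((1 + am j * am j) / (ap j - am j) * bracket_m j).

Definition flux1 (j : int) : R :=
  F (C (j - 1)) +
  (- am j) / (ap j - am j) *
    (F (C j) - F (C (j - 1)) - ap j * (C j - C (j - 1))).

Definition flux2 (j : int) : R :=
  ap j / (ap j - am j) * (van_leer (theta_p j) / 2) * bracket_p j -
  am j / (ap j - am j) * (van_leer (theta_m j) / 2) * bracket_m j.

Definition relaxed_step (dx dt : R) (j : int) : R :=
  C j - dt / dx * (flux1 (j + 1) - flux1 j)
      - dt / dx * (flux2 (j + 1) - flux2 j).

Definition diff_quotient (j : int) : R :=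
  (F (C j) - F (C (j - 1))) / (C j - C (j - 1)).

Definition symmetric_subchar : Prop :=
  forall j, ap j = - am j /\
    (C j <> C (j - 1) -> ap j >= `|diff_quotient j|).

Definition optimal_subchar : Prop :=
  forall j, C j <> C (j - 1) ->
    am j <= Num.min (diff_quotient j) 0 /\
    ap j >= Num.max (diff_quotient j) 0.

End Flux.
End Speeds.
End RelaxedScheme.

(* Main.v *)
(** Put P = [bracket_p], M = [bracket_m], s = a^+ - a^- and D_j = C_j - C_{j-1}.
    The scheme reads C'_j = C_j - U_j + V_{j+1}, where U_j gathers the terms
    with a^+ and V_j those with a^-.  Since phi(theta) = r * theta with
    0 <= r <= 2, the limited term of U_j at the interface j + 1/2 is a multiple
    of P_j, and so U_j = (dt/dx) c P_j / s_j and V_j = (dt/dx) d M_j / s_j with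
    0 <= c, d <= 2 a_max.  The subcharacteristic condition makes P_j / s_j and
    M_j / s_j nonnegative multiples of D_j, and they add up to D_j; the CFL
    condition then gives |D_j - U_j - V_j| = |D_j| - |U_j| - |V_j|, which is
    Harten's criterion. *)
Require Import Defs.
From HB Require Import structures.
From mathcomp Require Import all_boot all_order all_algebra.
From mathcomp Require Import all_classical all_reals all_analysis.
From mathcomp Require Import ring lra.

Set Implicit Arguments.
Unset Strict Implicit.
Unset Printing Implicit Defensive.

Import Order.TTheory GRing.Theory Num.Theory.

Local Open Scope classical_set_scope.
Local Open Scope ring_scope.

Lemma esum_shift (R : realType) (k : int) (f : int -> \bar R) :
  (forall j, 0 <= f j)%E ->
  \esum_(j in [set: int]) f (j + k) = \esum_(j in [set: int]) f j.
Proof.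
move=> f0; symmetry.
apply: (@reindex_esum R int int setT setT (fun j => j + k)) => //.
split=> //; first by move=> x y _ _ /addIr.
by move=> y _; exists (y - k) => //; rewrite subrK.
Qed.

(* Each [D j] keeps [D j - U j - V j] for itself, hands [U j] to its right
   neighbour and [V j] to its left one. *)
Lemma harten_tv (R : realType) (C C' U V : int -> R) :
  (grid_tv C < +oo)%E ->
  (forall j, C' j = C j - U j + V (j + 1)) ->
  (forall j, `|C j - C (j - 1) - U j - V j| + `|U j| + `|V j|
             <= `|C j - C (j - 1)|) ->
  (grid_tv C' <= grid_tv C)%E.
Proof.
move=> tvC stepE bnd.
pose S (f : int -> R) := (\esum_(j in [set: int]) (`|f j|)%:E)%E.
have nn (f : int -> R) j : (0 <= (`|f j|)%:E)%E by rewrite lee_fin.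
have shift k f : S (fun j => f (j + k)) = S f.
  exact: (esum_shift k (nn f)).
have tvE c : grid_tv c = S (fun j => c j - c (j - 1)).
  rewrite -(shift 1); apply: eq_esum => j _ /=; by rewrite addrK.
have SD f g : (S f + S g)%E = (\esum_(j in [set: int]) (`|f j| + `|g j|)%:E)%E.
  by rewrite -esumD.
have SU : (S U <= grid_tv C)%E.
  rewrite tvE; apply: le_esum => j _; rewrite lee_fin.
  by apply: le_trans (bnd j); rewrite -addrA addrCA lerDl addr_ge0.
have SV : (S V <= grid_tv C)%E.
  rewrite tvE; apply: le_esum => j _; rewrite lee_fin.
  by apply: le_trans (bnd j); rewrite lerDr addr_ge0.
have fin f : (S f <= grid_tv C)%E -> S f \is a fin_num.
  move=> h; rewrite ge0_fin_numE; first exact: le_lt_trans h tvC.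
  by apply: esum_ge0.
(* In the extended reals [S U + S V] may be added to both sides, and cancelled again, because it is
   finite. *)
have fUV : (S U + S V)%E \is a fin_num by rewrite fin_numD !fin.
rewrite -(leeD2rE _ _ fUV).
(* On the right, index [j] now carries the shares received from its neighbours, [U (j - 1)] and
   [V (j + 1)], so the sums compare term by term. *)
rewrite -[in leRHS](shift (-1) U) -[in leRHS](shift 1 V) !tvE.
rewrite !SD -!esumD //; try by move=> j _; rewrite lee_fin addr_ge0.
apply: le_esum => j _; rewrite -!EFinD lee_fin !stepE subrK.
have := bnd j.
set d := C j - _; set u := U j; set v := V j; set u' := U _; set v' := V _.
have -> : C j - u + v' - (C (j - 1) - u' + v) = (d - u - v) + (u' + v').
  by rewrite /d; ring.
have := ler_normD (d - u - v) (u' + v').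
have := ler_normD u' v'.
lra.
Qed.

Lemma van_leer_itv (R : realType) (t : R) : 0 <= van_leer t <= 2.
Proof.
have h : 0 < 1 + `|t| by rewrite ltr_pwDl.
have := ler_norm t; have := ler_norm (- t); rewrite normrN => h1 h2.
rewrite /van_leer divr_ge0 ?ler_pdivrMr //=; lra.
Qed.

(** The ratio phi(t) / t is 2 / (1 + t) for t > 0 and 0 for t < 0. Multiplying through by [y] also
    covers a vanishing denominator, with r = 0. *)
Lemma van_leer_divK (R : realType) (x y : R) :
  exists2 r, 0 <= r <= 2 & van_leer (x / y) * y = r * x.
Proof.
have [->|y0] := eqVneq y 0; first by exists 0; rewrite ?mulr0 ?mul0r ?lexx //=.
set t := x / y; have xE : x = t * y by rewrite /t divfK.
have [t0|t0] := leP t 0.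
  exists 0; rewrite ?lexx //= /van_leer ler0_norm // subrr; ring.
have h : 0 < 1 + t by lra.
exists (2 / (1 + t)); first by rewrite divr_ge0 ?ler_pdivrMr //=; lra.
rewrite xE /van_leer gtr0_norm //; field; lra.
Qed.

(* The factors [1 + p' * p] and [1 + p' * p'] of the limiter parameter make
   [p' * (1 + p' * p) / (1 + p' * p')] a convex combination of [p'] and [p],
   with weights proportional to [1] and [p' ^ 2]. *)
Lemma limited_flux_coef (R : realType) (a p p' s s' t P P' : R) :
  0 <= p <= a -> 0 <= p' <= a -> 0 < s' ->
  exists2 c, 0 <= c <= 2 * a &
    p / s * (1 - van_leer t / 2) * P
    + p' / s' * (van_leer ((1 + p' * p) / s * P / ((1 + p' * p') / s' * P')) / 2)
      * P' = c * (P / s).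
Proof.
move=> /andP[p0 pa] /andP[p'0 p'a] s'0.
set X := _ / s * P; set Y := _ / s' * P'.
have [r /andP[r0 r2] rE] := van_leer_divK X Y.
have /andP[f0 f2] := van_leer_itv t.
have q0 : 0 < 1 + p' * p' by rewrite ltr_pwDl // mulr_ge0.
pose w := p' * (1 + p' * p) / (1 + p' * p').
have w0 : 0 <= w by rewrite divr_ge0 ?mulr_ge0 ?addr_ge0 ?mulr_ge0 // ltW.
have wa : w <= a.
  rewrite ler_pdivrMr // mulrDr mulr1 mulrDr mulr1 lerD // mulrA mulrC.
  by rewrite ler_wpM2r // mulr_ge0.
(* Each summand lies in [0, a], since phi / 2 and r / 2 both lie in [0, 1]. *)
exists (p * (1 - van_leer t / 2) + r / 2 * w).
  apply/andP; split.
    by rewrite addr_ge0 // mulr_ge0 //; lra.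
  have h1 : p * (1 - van_leer t / 2) <= p * 1 by rewrite ler_wpM2l //; lra.
  have h2 : r / 2 * w <= 1 * w by rewrite ler_wpM2r //; lra.
  lra.
have -> : p' / s' * (van_leer (X / Y) / 2) * P' =
    p' / (1 + p' * p') / 2 * (van_leer (X / Y) * Y).
  by rewrite /Y; field; rewrite !gt_eqF.
rewrite rE /X /w; ring.
Qed.

(** Both subcharacteristic conditions reduce to this form. Where [C] does not jump, q = 0 works, by
    the signs of the speeds. *)
Lemma subchar_quotient (R : realType) (ap am : int -> R) F C :
  speeds_ok ap am ->
  symmetric_subchar ap am F C \/ optimal_subchar ap am F C ->
  forall j, exists2 q, am j <= q <= ap j &
    F (C j) - F (C (j - 1)) = q * (C j - C (j - 1)).
Proof.
move=> ok sub j; have [m0 [p0 _]] := ok j.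
have [e|/eqP ne] := eqVneq (C j) (C (j - 1)).
  by exists 0; rewrite ?m0 //= e !subrr mulr0.
exists (diff_quotient F C j); last first.
  by rewrite /diff_quotient divfK // subr_eq0; apply/eqP.
case: sub => [/(_ j)[e /(_ ne)]|/(_ j ne)[]].
  by rewrite ler_norml e opprK.
by rewrite le_min ge_max => /andP[-> _] /andP[-> _].
Qed.

Lemma speed_le_a_max (R : realType) (ap am : int -> R) j :
  has_ubound (speed_set ap am) ->
  ap j <= a_max ap am /\ - am j <= a_max ap am.
Proof.
move=> ub; have : Num.max (ap j) `|am j| <= a_max ap am.
  by apply: ub_le_sup => //; exists j.
rewrite ge_max => /andP[-> h]; split=> //.
by apply: le_trans h; rewrite -normrN ler_norm.
Qed.

Theorem theorem3p2 (R : realType) (F : R -> R) (dx dt : R)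
    (hdx : 0 < dx) (hdt : 0 < dt)
    (C : int -> R) (hC : (grid_tv C < +oo)%E)
    (ap am : int -> R) (hspeeds : speeds_ok ap am)
    (hbounded : has_ubound (speed_set ap am))
    (hCFL : dt / dx * a_max ap am <= 1 / 2)
    (hsub : symmetric_subchar ap am F C \/ optimal_subchar ap am F C) :
  (grid_tv (relaxed_step ap am F C dx dt) <= grid_tv C)%E.
Proof.
pose s j := ap j - am j.
pose P := bracket_p am F C; pose M := bracket_m ap F C.
pose fp j := van_leer (theta_p ap am F C j).
pose fm j := van_leer (theta_m ap am F C j).
pose U j := dt / dx * (ap j / s j * (1 - fp j / 2) * P j
  + ap (j + 1) / s (j + 1) * (fp (j + 1) / 2) * P (j + 1)).
pose V j := dt / dx * (- am j / s j * (1 - fm j / 2) * M j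
  + - am (j - 1) / s (j - 1) * (fm (j - 1) / 2) * M (j - 1)).
have s0 j : 0 < s j by have [_ []] := hspeeds j.
have l0 : 0 < dt / dx by rewrite divr_gt0.
apply: (@harten_tv _ _ _ U V) => // j.
  (* Behind the identity: F_j minus the first order flux at j - 1/2 is a^+ P_j / s_j, and the flux
     at j + 1/2 minus F_j is a^- M_{j+1} / s_{j+1}. *)
  have sj := s0 j; have sj1 := s0 (j + 1).
  rewrite /relaxed_step /U /V /flux1 /flux2 -/P -/M -/(fp _) -/(fm _) !addrK.
  rewrite /P /M /bracket_p /bracket_m !addrK -/(fp _) -/(fm _) -/(fp _) -/(fm _).
  move: (fp _) (fp _) (fm _) (fm _) => f1 f2 f3 f4.
  move: sj sj1; rewrite /s => sj sj1.
  by field; rewrite !gt_eqF.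
have [q /andP[mq qp] qE] := subchar_quotient hspeeds hsub j.
have itvp i : 0 <= ap i <= a_max ap am.
  by have [_ [-> _]] := hspeeds i; have [-> _] := speed_le_a_max i hbounded.
have itvm i : 0 <= - am i <= a_max ap am.
  by rewrite oppr_ge0; have [-> _] := hspeeds i;
    have [_ ->] := speed_le_a_max i hbounded.
have [c c_itv cE] : exists2 c, 0 <= c <= 2 * a_max ap am &
    U j = dt / dx * (c * (P j / s j)).
  have [c ? cE] := limited_flux_coef (s j) (theta_p ap am F C j) (P j)
    (P (j + 1)) (itvp j) (itvp (j + 1)) (s0 (j + 1)).
  by exists c => //; rewrite -cE /U /fp {2}/theta_p addrK.
have [d d_itv dE] : exists2 d, 0 <= d <= 2 * a_max ap am &
    V j = dt / dx * (d * (M j / s j)).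
  (* Mirror image of the bound for [U]: the speeds are [- am] and the neighbouring interface is
     [j - 1]; the signs cancel in the products of speeds. *)
  have [d ? dE] := limited_flux_coef (s j) (theta_m ap am F C j) (M j)
    (M (j - 1)) (itvm j) (itvm (j - 1)) (s0 (j - 1)).
  exists d => //; rewrite -dE /V /fm {2}/theta_m subrK !mulrNN.
  by rewrite (mulrC (am j) (am (j - 1))).
set D := C j - C (j - 1) in qE *.
pose u := dt / dx * c * ((q - am j) / s j).
pose v := dt / dx * d * ((ap j - q) / s j).
have UE : U j = u * D by rewrite cE /u /P /bracket_p qE -/D; ring.
have VE : V j = v * D by rewrite dE /v /M /bracket_m qE -/D; ring.
have x0 : 0 <= (q - am j) / s j.
  by apply: divr_ge0 (ltW (s0 j)); rewrite subr_ge0.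
have y0 : 0 <= (ap j - q) / s j.
  by apply: divr_ge0 (ltW (s0 j)); rewrite subr_ge0.
have xy1 : (q - am j) / s j + (ap j - q) / s j = 1.
  by have := s0 j; rewrite /s => h; field; rewrite gt_eqF.
(* The CFL constant 1/2 absorbs the factor 2 in the bound on [c] and [d]. *)
have coef e : 0 <= e <= 2 * a_max ap am -> 0 <= dt / dx * e <= 1.
  move=> /andP[e0 e2]; rewrite mulr_ge0 ?(ltW l0) //=.
  have : dt / dx * e <= dt / dx * (2 * a_max ap am) by rewrite ler_pM2l.
  lra.
have /andP[c0 c1] := coef _ c_itv; have /andP[d0 d1] := coef _ d_itv.
have u0 : 0 <= u by rewrite mulr_ge0.
have v0 : 0 <= v by rewrite mulr_ge0.
have uv1 : u + v <= 1 by rewrite -xy1 lerD // ler_piMl.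
have -> : D - U j - V j = (1 - u - v) * D by rewrite UE VE; ring.
rewrite UE VE (normrM u) (normrM v) (normrM (1 - u - v)).
rewrite (ger0_norm u0) (ger0_norm v0) ger0_norm; last lra.
by rewrite -!mulrDl addrAC !subrK mul1r.
Qed.
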